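(* Let $n, m \geq 1$, and for each $j = 1,\dots,m$ let $Q_j \in \mathbb{R}^{n\times n}$ be a symmetric positive definite matrix and $x_j^f \in \mathbb{R}^n$. Then the map $$\kappa(\alpha) = \Big(\sum_{j=1}^m \alpha_j Q_j\Big)^{-1}\Big(\sum_{j=1}^m \alpha_j Q_j x_j^f\Big), \qquad \alpha \in \Delta^m,$$ is a continuous surjection from $\Delta^m$ onto $\mathcal{G}$.
   Context: $\Delta^m = \{\alpha \in \mathbb{R}^m \mid \alpha_i \geq 0 \text{ for all } i,\ \sum_{i=1}^m \alpha_i = 1\}$ is the probability simplex. The data define strictly convex quadratic functions $f_j(x) = \tfrac12 (x - x_j^f)^T Q_j (x - x_j^f)$ on $\mathbb{R}^n$ and, for $\alpha \in \Delta^m$, the cost $f_\alpha = \sum_{j=1}^m \alpha_j f_j$. The set of global optima and weights is $$\hat{\mathcal{G}} = \Big\{(x,\alpha) \in \mathbb{R}^n \times \Delta^m \;\Big|\; \nabla_x f_\alpha(x) = 0\Big\} = \Big\{(x,\alpha) \in \mathbb{R}^n \times \Delta^m \;\Big|\; \Big(\sum_{j=1}^m \alpha_j Q_j\Big) x = \sum_{j=1}^m \alpha_j Q_j x_j^f\Big\},$$ and the set of global optima is its projection $\mathcal{G} = \{x \in \mathbb{R}^n \mid \exists \alpha \in \Delta^m : (x,\alpha) \in \hat{\mathcal{G}}\}$. *)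

(* Defs.v *)
From mathcomp Require Import all_boot all_order all_algebra.
From mathcomp Require Import all_classical all_reals all_analysis.
Set Implicit Arguments.
Unset Strict Implicit.
Unset Printing Implicit Defensive.
Import Order.TTheory GRing.Theory Num.Theory.
Import numFieldNormedType.Exports.
Local Open Scope classical_set_scope.
Local Open Scope ring_scope.

Definition posdefmx (R : realType) (n : nat) (A : 'M[R]_n) : Prop :=
  A^T = A /\ forall v : 'cV[R]_n, v != 0 -> 0 < (v^T *m A *m v) 0 0.

Definition simplex (R : realType) (m : nat) : set 'cV[R]_m :=
  [set alpha | (forall i, 0 <= alpha i 0) /\ \sum_i alpha i 0 = 1].

(* Column of partial derivatives. ['D_v f x] is a total operator, but the costs
   below are polynomial, so every partial derivative taken exists. The type
   [R^o] is [R] as a normed module over itself. *)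
Definition gradient (R : realType) (n : nat) (f : 'cV[R]_n -> R^o)
    (x : 'cV[R]_n) : 'cV[R]_n :=
  \col_i 'D_(delta_mx i 0) f x.

Section Costs.
Variables (R : realType) (n m : nat).
Variables (Q : 'I_m -> 'M[R]_n) (xf : 'I_m -> 'cV[R]_n).

Definition quad_cost (j : 'I_m) (x : 'cV[R]_n) : R :=
  2^-1 * ((x - xf j)^T *m Q j *m (x - xf j)) 0 0.

Definition weighted_cost (alpha : 'cV[R]_m) (x : 'cV[R]_n) : R :=
  \sum_j alpha j 0 * quad_cost j x.

Definition optima_weights : set ('cV[R]_n * 'cV[R]_m) :=
  [set p | simplex p.2 /\ gradient (weighted_cost p.2) p.1 = 0].

Definition global_optima : set 'cV[R]_n :=
  [set x | exists2 alpha, simplex alpha & optima_weights (x, alpha)].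

(* On the simplex the matrix is positive definite, so the value of [invmx] at
   singular matrices plays no role there. *)
Definition kappa (alpha : 'cV[R]_m) : 'cV[R]_n :=
  invmx (\sum_j alpha j 0 *: Q j) *m (\sum_j alpha j 0 *: (Q j *m xf j)).

End Costs.

(* Main.v *)
(* A convex combination of positive definite matrices is positive definite, so
   the linear system expressing the stationarity of the weighted cost has
   [kappa alpha] as its only solution: the global optima are exactly the values
   of kappa on the simplex. Continuity follows from the cofactor formula for the
   inverse, whose determinant does not vanish on the simplex. *)
Require Import Defs.
From mathcomp Require Import all_boot all_order all_algebra.
From mathcomp Require Import all_classical all_reals all_analysis.
From mathcomp Require Import ring.
Set Implicit Arguments.
Unset Strict Implicit.
Unset Printing Implicit Defensive.
Import Order.TTheory GRing.Theory Num.Theory.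
Import numFieldNormedType.Exports.
Local Open Scope classical_set_scope.
Local Open Scope ring_scope.

(** A basic neighbourhood of a matrix prescribes one neighbourhood per entry; there are finitely
    many entries, so the filter may intersect the conditions. *)
Lemma cvg_mx_coord (T : Type) (U : topologicalType) (m n : nat)
    (F : set_system T) {FF : Filter F} (f : T -> 'M[U]_(m, n)) (M : 'M[U]_(m, n)) :
  (forall i j, f x i j @[x --> F] --> M i j) ->
  f x @[x --> F] --> M.
Proof.
move=> fM A [P MP sPA].
have : \forall x \near F, forall i j, P i j (f x i j).
  by do 2!apply: filter_forall => ?; exact/fM/MP.
by apply: filterS => x Px; exact: sPA.
Qed.

Section MatrixLimits.
Variables (R : realType) (T : Type) (F : set_system T).
Context {FF : Filter F}.

Lemma cvg_sumr (I : Type) (r : seq I) (P : pred I) (f : I -> T -> R) (l : I -> R) :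
  (forall i, P i -> f i x @[x --> F] --> l i) ->
  \sum_(i <- r | P i) f i x @[x --> F] --> \sum_(i <- r | P i) l i.
Proof. by apply: cvg_big; exact: add_continuous. Qed.

Lemma cvg_prodr (I : Type) (r : seq I) (P : pred I) (f : I -> T -> R) (l : I -> R) :
  (forall i, P i -> f i x @[x --> F] --> l i) ->
  \prod_(i <- r | P i) f i x @[x --> F] --> \prod_(i <- r | P i) l i.
Proof. by apply: cvg_big; exact: mul_continuous. Qed.

Lemma cvg_mxE (m n : nat) (f : T -> 'M[R]_(m, n)) (M : 'M[R]_(m, n)) i j :
  f x @[x --> F] --> M -> f x i j @[x --> F] --> M i j.
Proof.
move=> fM; apply: (cvg_comp f (fun N : 'M[R]_(m, n) => N i j) fM).
exact: coord_continuous.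
Qed.

Lemma cvg_mulmx (m n p : nat) (f : T -> 'M[R]_(m, n)) (g : T -> 'M[R]_(n, p))
    (A : 'M[R]_(m, n)) (B : 'M[R]_(n, p)) :
  f x @[x --> F] --> A -> g x @[x --> F] --> B ->
  f x *m g x @[x --> F] --> A *m B.
Proof.
move=> fA gB; apply: cvg_mx_coord => i j; rewrite mxE.
under eq_cvg do rewrite mxE.
by apply: cvg_sumr => k _; apply: cvgM; exact: cvg_mxE.
Qed.

Lemma cvg_det (n : nat) (f : T -> 'M[R]_n) (A : 'M[R]_n) :
  f x @[x --> F] --> A -> \det (f x) @[x --> F] --> \det A.
Proof.
move=> fA; apply: cvg_sumr => s _; apply: cvgM; first exact: cvg_cst.
by apply: cvg_prodr => i _; exact: cvg_mxE.
Qed.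

Lemma cvg_adjmx (n : nat) (f : T -> 'M[R]_n) (A : 'M[R]_n) :
  f x @[x --> F] --> A -> \adj (f x) @[x --> F] --> \adj A.
Proof.
move=> fA; apply: cvg_mx_coord => i j; rewrite mxE.
under eq_cvg do rewrite mxE.
apply: cvgM; first exact: cvg_cst.
apply: cvg_det; apply: cvg_mx_coord => k l; rewrite !mxE.
by under eq_cvg do rewrite !mxE; exact: cvg_mxE.
Qed.

Lemma cvg_invmx (n : nat) (f : T -> 'M[R]_n) (A : 'M[R]_n) :
  A \in unitmx -> f x @[x --> F] --> A -> invmx (f x) @[x --> F] --> invmx A.
Proof.
rewrite unitmxE unitfE => A0 fA.
have fdet := cvg_det fA.
have f0 : \forall x \near F, \det (f x) != 0 by apply: cvgr_neq0 fdet A0.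
have invE (B : 'M[R]_n) : \det B != 0 -> invmx B = (\det B)^-1 *: \adj B.
  by rewrite /invmx unitmxE unitfE => ->.
rewrite (invE _ A0).
(* On singular matrices [invmx] returns its argument, so the cofactor formula holds only eventually
   along [F], where the determinant has become nonzero. *)
apply: (@cvg_trans _ ((\det (f x))^-1 *: \adj (f x) @[x --> F])).
  apply: near_eq_cvg; apply: filterS f0 => x fx0; exact/esym/invE.
apply: cvg_mx_coord => i j; rewrite mxE.
under eq_cvg do rewrite mxE.
apply: cvgM; first exact: cvgV.
exact/cvg_mxE/cvg_adjmx.
Qed.

End MatrixLimits.

Section PositiveDefinite.
Variables (R : realType) (n : nat).
Implicit Types A : 'M[R]_n.

(** A singular matrix kills some nonzero row vector on the left, and the quadratic form would vanish
    at its transpose. *)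
Lemma posdefmx_unit A : posdefmx A -> A \in unitmx.
Proof.
move=> [_ Apos]; rewrite unitmxE unitfE; apply/negP => /det0P[v v0 vA0].
have := Apos v^T; rewrite trmxK vA0 mul0mx mxE ltxx => vT0.
suff /vT0 : v^T != 0 by [].
by rewrite -(inj_eq (can_inj (@trmxK _ _ _))) trmxK trmx0.
Qed.

Lemma posdefmx_simplex_sum (m : nat) (Q : 'I_m -> 'M[R]_n) (alpha : 'cV[R]_m) :
  (forall j, posdefmx (Q j)) -> simplex alpha ->
  posdefmx (\sum_j alpha j 0 *: Q j).
Proof.
move=> Qpos [alpha0 alpha1]; split.
  by rewrite raddf_sum; apply: eq_bigr => j _; rewrite /= linearZ/= (Qpos j).1.
move=> v v0; rewrite mulmx_sumr mulmx_suml summxE.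
have term0 j : 0 <= (v^T *m (alpha j 0 *: Q j) *m v) 0 0.
  by rewrite -scalemxAr -scalemxAl mxE mulr_ge0// ltW// (Qpos j).2.
(* If this sum of nonnegative terms were zero, each term would be zero, hence each weight too,
   against the weights summing to 1. *)
rewrite lt_neqAle sumr_ge0// andbT eq_sym; apply/negP => /eqP sum0.
have alphaz j : alpha j 0 = 0.
  have /eqP : (v^T *m (alpha j 0 *: Q j) *m v) 0 0 = 0.
    exact: (psumr_eq0P (fun i _ => term0 i) sum0).
  rewrite -scalemxAr -scalemxAl mxE mulf_eq0 => /orP[/eqP//|].
  by rewrite gt_eqF// (Qpos j).2.
by move/eqP: alpha1; rewrite big1// eq_sym oner_eq0.
Qed.

End PositiveDefinite.

(** For nonzero [h] the difference quotient is exactly [b + h * c], which tends to [b]. *)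
Lemma derive_quadratic (R : realType) (V : normedModType R) (f : V -> R^o)
    (x v : V) (b c : R) :
  (forall h : R, f (h *: v + x) - f x = h * b + h ^+ 2 * c) -> 'D_v f x = b.
Proof.
move=> fE; apply: cvg_lim => //.
apply: (@cvg_trans _ ((b + h * c : R^o) @[h --> (0 : R)^'])).
  apply: near_eq_cvg; near=> h.
  have h0 : h != 0 by near: h; exact: nbhs_dnbhs_neq.
  by rewrite /= fE /GRing.scale/=; field.
apply: cvg_within_filter.
have {2}-> : b = b + 0 * c by rewrite mul0r addr0.
by apply: cvgD; [exact: cvg_cst|apply: cvgM; [exact: cvg_id|exact: cvg_cst]].
Unshelve. all: by end_near. Qed.

Section Optima.
Variables (R : realType) (n m : nat).
Variables (Q : 'I_m -> 'M[R]_n) (xf : 'I_m -> 'cV[R]_n).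
Hypothesis Q_posdef : forall j, posdefmx (Q j).

Lemma quad_cost_shift j (h : R) (v x : 'cV[R]_n) :
  quad_cost Q xf j (h *: v + x) - quad_cost Q xf j x =
  h * (v^T *m (Q j *m (x - xf j))) 0 0 + h ^+ 2 * (2^-1 * (v^T *m Q j *m v) 0 0).
Proof.
rewrite /quad_cost -addrA; move: (x - xf j) => y.
have addE (A B : 'M[R]_1) : (A + B) 0 0 = A 0 0 + B 0 0 by rewrite mxE.
have scaleE (a : R) (A : 'M[R]_1) : (a *: A) 0 0 = a * A 0 0 by rewrite mxE.
(* Symmetry of [Q j] makes the two cross terms equal, so together they absorb the factor one
   half. *)
have sym : (y^T *m Q j *m v) 0 0 = (v^T *m Q j *m y) 0 0.
  transitivity ((v^T *m Q j *m y)^T 0 0); last by rewrite mxE.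
  by rewrite !trmx_mul trmxK (Q_posdef j).1 mulmxA.
have -> : (h *: v + y)^T = h *: v^T + y^T by rewrite linearD/= linearZ.
rewrite !(mulmxDl, mulmxDr) -!scalemxAr -!scalemxAl !addE !scaleE sym mulmxA.
by field.
Qed.

Lemma gradient_weighted_cost (alpha : 'cV[R]_m) (x : 'cV[R]_n) :
  gradient (weighted_cost Q xf alpha) x =
  (\sum_j alpha j 0 *: Q j) *m x - \sum_j alpha j 0 *: (Q j *m xf j).
Proof.
have -> : (\sum_j alpha j 0 *: Q j) *m x - \sum_j alpha j 0 *: (Q j *m xf j)
    = \sum_j alpha j 0 *: (Q j *m (x - xf j)).
  rewrite mulmx_suml -sumrB; apply: eq_bigr => j _.
  by rewrite -scalemxAl -scalerBr -mulmxBr.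
apply/colP => i; rewrite mxE summxE.
pose v : 'cV[R]_n := delta_mx i 0.
(* The coefficient of [h ^+ 2] in the expansion of the weighted cost along the basis vector [v]. *)
pose c := \sum_j alpha j 0 * (2^-1 * (v^T *m Q j *m v) 0 0).
apply: (@derive_quadratic _ _ _ _ _ _ c) => h.
rewrite /weighted_cost -sumrB !mulr_sumr -big_split/=; apply: eq_bigr => j _.
rewrite -mulrBr quad_cost_shift trmx_delta -rowE !mxE; ring.
Qed.

Lemma optima_weightsE (x : 'cV[R]_n) (alpha : 'cV[R]_m) :
  simplex alpha -> optima_weights Q xf (x, alpha) <-> x = kappa Q xf alpha.
Proof.
move=> alphaS; have Au := posdefmx_unit (posdefmx_simplex_sum Q_posdef alphaS).
rewrite /optima_weights/= gradient_weighted_cost /kappa; split.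
  by move=> [_ /eqP]; rewrite subr_eq0 => /eqP <-; rewrite mulKmx.
by move=> ->; split=> //; rewrite mulKVmx// subrr.
Qed.

(** Continuity holds in the ambient space, not just relative to the simplex: [cvg_invmx] asks for
    invertibility at the limit point only, and both sums are linear in the weights. *)
Lemma kappa_continuous (alpha : 'cV[R]_m) :
  simplex alpha -> {for alpha, continuous (kappa Q xf)}.
Proof.
move=> alphaS.
have sum_cvg p (B : 'I_m -> 'M[R]_(n, p)) :
    (fun beta : 'cV[R]_m => \sum_j beta j 0 *: B j) @ alpha --> \sum_j alpha j 0 *: B j.
  apply: (@cvg_mx_coord _ _ _ _ (nbhs alpha)) => i k; rewrite summxE.
  under eq_cvg do rewrite summxE.
  apply: cvg_sumr => j _; rewrite mxE.
  under eq_cvg do rewrite mxE.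
  by apply: cvgM; [exact: coord_continuous|exact: cvg_cst].
have Au := posdefmx_unit (posdefmx_simplex_sum Q_posdef alphaS).
exact: cvg_mulmx (cvg_invmx Au (sum_cvg _ Q)) (sum_cvg _ _).
Qed.

End Optima.

Theorem mainTheorem1 (R : realType) (n m : nat) (n_ge1 : (1 <= n)%N)
    (m_ge1 : (1 <= m)%N) (Q : 'I_m -> 'M[R]_n) (xf : 'I_m -> 'cV[R]_n)
    (Q_posdef : forall j, posdefmx (Q j)) :
  [/\ {within @simplex R m, continuous (kappa Q xf)},
      set_fun (@simplex R m) (global_optima Q xf) (kappa Q xf) &
      set_surj (@simplex R m) (global_optima Q xf) (kappa Q xf)].
Proof.
split.
- apply: continuous_in_subspaceT => alpha; rewrite inE.
  exact: kappa_continuous.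
- by move=> alpha alphaS; exists alpha => //; exact/optima_weightsE.
(* The weight that certifies [x] as an optimum is itself a preimage of [x]. *)
- by move=> x [alpha alphaS /optima_weightsE ->//]; exists alpha.
Qed.
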